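(* Let $h>0$, let $A_h=\frac{1}{h^2}\begin{bmatrix}&-1&\\-1&4&-1\\&-1&\end{bmatrix}$ be the five-point discrete Laplacian on $h\mathbb{Z}^2$ and let $$M_{fe}=\frac{h^2}{36}\begin{bmatrix}1&4&1\\4&16&4\\1&4&1\end{bmatrix}$$ be the mass stencil of bilinear finite elements. Consider the relaxation scheme $S_{fe}=I-\omega M_{fe}A_h$, $\omega\in\mathbb{R}$. Let $\widetilde{A}_h(\boldsymbol\theta)$ and $\widetilde{M}_{fe}(\boldsymbol\theta)$, $\boldsymbol\theta=(\theta_1,\theta_2)$, denote the symbols of $A_h$ and $M_{fe}$, and let $T^{\rm high}=[-\frac{\pi}{2},\frac{3\pi}{2})^2\setminus[-\frac{\pi}{2},\frac{\pi}{2})^2$. Then the corresponding optimal smoothing factor is $$\mu_{fe,\rm opt}=\min_{\omega\in\mathbb{R}}\ \max_{\boldsymbol\theta\in T^{\rm high}}\left|1-\omega\,\widetilde{M}_{fe}(\boldsymbol\theta)\widetilde{A}_h(\boldsymbol\theta)\right|=\frac{1}{3},$$ and the minimum over $\omega$ is uniquely achieved at $\omega=\frac{3}{4}$.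
   Context: Grid functions are functions $u:h\mathbb{Z}^2\to\mathbb{C}$. A stencil $[s_{\boldsymbol k}]_{\boldsymbol k\in\mathbb{Z}^2}$ (finitely many nonzero entries, the centre entry of the displayed array being $\boldsymbol k=0$) defines the operator $(Su)(\boldsymbol x)=\sum_{\boldsymbol k} s_{\boldsymbol k}\,u(\boldsymbol x+h\boldsymbol k)$. The symbol of such an operator $S$ is the function $\widetilde{S}(\boldsymbol\theta)$ with $S e^{\iota\boldsymbol\theta\cdot\boldsymbol x/h}=\widetilde{S}(\boldsymbol\theta)e^{\iota\boldsymbol\theta\cdot\boldsymbol x/h}$, where $\iota^2=-1$. *)

(* Defs.v *)
From HB Require Import structures.
From mathcomp Require Import all_boot all_order all_algebra.
From mathcomp Require Import complex ring lra.
From mathcomp Require Import all_classical all_reals all_analysis.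

Set Implicit Arguments.
Unset Strict Implicit.
Unset Printing Implicit Defensive.

Import Order.TTheory GRing.Theory Num.Theory.

Local Open Scope classical_set_scope.
Local Open Scope ring_scope.
Local Open Scope complex_scope.

Section Grid.
Context {R : realType}.
Implicit Types (h : R) (k : int * int) (theta : R * R).

Definition hgrid h : set (R * R) :=
  range (fun j : int * int => (h * j.1%:~R, h * j.2%:~R)).

Definition gridfun h := hgrid h -> R[i].

Lemma hgrid_shift h (x : hgrid h) k :
  hgrid h ((val x).1 + h * k.1%:~R, (val x).2 + h * k.2%:~R).
Proof.
have [j _ jx] := set_mem (valP x).
exists (j.1 + k.1, j.2 + k.2) => //=.
by rewrite -jx /= !intrD !mulrDr.
Qed.

Definition gshift h (x : hgrid h) k : hgrid h := SigSub (mem_set (hgrid_shift x k)).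

(* For a finitely supported s this is the finite sum over all of Z^2;
   \sum_(k \in setT) is 0 by convention when the support is infinite. *)
Definition stencil_op h (s : int * int -> R) (u : gridfun h) : gridfun h :=
  fun x => \sum_(k \in [set: int * int]) ((s k)%:C * u (gshift x k)).

(* The rows of the 3 x 3 array run from top (k.2 = 1) to bottom (k.2 = -1),
   its columns from left (k.1 = -1) to right (k.1 = 1). *)
Definition stencil3 (a : seq (seq R)) k : R :=
  if (`|k.1| <= 1) && (`|k.2| <= 1)
  then nth 0 (nth [::] a (absz (1 - k.2))) (absz (1 + k.1)) else 0.

Definition laplace5 h k : R :=
  h ^- 2 * stencil3 [:: [::  0; -1;  0];
                        [:: -1;  4; -1];
                        [::  0; -1;  0]] k.

Definition mass_fe h k : R :=
  h ^+ 2 / 36 * stencil3 [:: [:: 1;  4; 1];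
                             [:: 4; 16; 4];
                             [:: 1;  4; 1]] k.

Definition S_fe h (omega : R) (u : gridfun h) : gridfun h :=
  fun x => u x - omega%:C * stencil_op (mass_fe h) (stencil_op (laplace5 h) u) x.

Definition expi (t : R) : R[i] := cos t +i* sin t.

Definition fourier_mode h theta : gridfun h :=
  fun x => expi ((theta.1 * (val x).1 + theta.2 * (val x).2) / h).

Definition is_symbol h (S : gridfun h -> gridfun h) (sigma : R * R -> R[i]) :=
  forall theta x, S (fourier_mode theta) x = sigma theta * fourier_mode theta x.

Definition T_high : set (R * R) :=
  (`[- (pi / 2), 3 * pi / 2[ `*` `[- (pi / 2), 3 * pi / 2[) `\`
  (`[- (pi / 2), pi / 2[ `*` `[- (pi / 2), pi / 2[).

Definition is_maximum (A : set R) m := A m /\ ubound A m.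

Definition is_minimum (A : set R) m := A m /\ lbound A m.

(* The smoothing factor of the relaxation scheme with symbol sigma is mu;
   Normc.normc is the R-valued modulus. *)
Definition is_smoothing_factor (sigma : R * R -> R[i]) (mu : R) :=
  is_maximum [set Normc.normc (sigma theta) | theta in T_high] mu.

Lemma expiD s t : expi (s + t) = expi s * expi t.
Proof. by rewrite /expi cosD sinD; congr (_ +i* _); ring. Qed.

Lemma expi_neq0 t : expi t != 0.
Proof.
apply/eqP => -[c0 s0]; have := cos2Dsin2 t.
by rewrite c0 s0 expr0n addr0 => /esym/eqP; rewrite oner_eq0.
Qed.

Lemma fourier_mode_shift h theta (x : hgrid h) k : h != 0 ->
  fourier_mode theta (gshift x k) =
  expi (theta.1 * k.1%:~R + theta.2 * k.2%:~R) * fourier_mode theta x.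
Proof.
move=> h0; rewrite /fourier_mode -expiD /=; congr expi.
by field.
Qed.

Lemma stencil_op_symbol h (s : int * int -> R) : h != 0 ->
  is_symbol (@stencil_op h s) (fun theta => \sum_(k \in [set: int * int])
    ((s k)%:C * expi (theta.1 * k.1%:~R + theta.2 * k.2%:~R))).
Proof.
move=> h0 theta x; rewrite mulrC mulr_fsumr; apply: eq_fsbigr => k _.
by rewrite fourier_mode_shift// mulrA mulrC.
Qed.

Lemma is_symbol_unique h S sigma sigma' :
  @is_symbol h S sigma -> is_symbol S sigma' -> sigma = sigma'.
Proof.
move=> H H'; apply/funext => theta.
have g0 : hgrid h (h * 0%:~R, h * 0%:~R) by exists (0, 0).
apply: (mulIf (expi_neq0 _)).
exact: etrans (esym (H theta (SigSub (mem_set g0)))) (H' _ _).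
Qed.

End Grid.

Arguments stencil_op {R} h s u x.
Arguments S_fe {R} h omega u x.

(* Main.v *)
(* With a = cos theta1 and b = cos theta2, the product of the two symbols is
   f(a, b) = 2/9 (2 + a)(2 + b)(2 - a - b), independently of h. A high
   frequency has a <= 0 or b <= 0, and there f ranges between 8/9, attained at
   theta = (pi, pi), and 16/9, attained at theta = (pi/2, pi/2). Hence the
   smoothing factor is max(|1 - 8/9 omega|, |1 - 16/9 omega|), which is at
   least max(1 - 8/9 omega, 16/9 omega - 1); these two lines, one decreasing
   and one increasing, cross at omega = 3/4 with the value 1/3. *)
Require Import Defs.
From mathcomp Require Import all_boot all_order all_algebra.
From mathcomp Require Import complex.
From mathcomp Require Import all_classical all_reals all_analysis.
From mathcomp Require Import zify ring lra.

Import Order.TTheory GRing.Theory Num.Theory.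
Local Open Scope classical_set_scope.
Local Open Scope ring_scope.
Local Open Scope complex_scope.

(** Opposite offsets carry equal weights, so their exponentials pair into cosines and the symbol is
    real. *)
Lemma stencil3_symbol (R : realType) (h c a b d : R) : h != 0 ->
  is_symbol (stencil_op h (fun k => c * stencil3 [:: [:: d; b; d];
                                                    [:: b; a; b];
                                                    [:: d; b; d]] k))
    (fun theta => (c * (a + 2 * b * (cos theta.1 + cos theta.2)
                          + 4 * d * (cos theta.1 * cos theta.2)))%:C).
Proof.
move=> h0 theta x; rewrite stencil_op_symbol//; congr (_ * _).
set one3 : seq int := [:: -1; 0; 1].
pose s : seq (int * int) := [seq (i, j) | i <- one3, j <- one3].
(* The entries vanish off the nine offsets in [s], which makes the sum explicit. *)
rewrite -(@fsbig_widen _ _ _ _ [set` s]) //; last first.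
  move=> -[i j] /= [_ ijs]; rewrite /stencil3 /=.
  case: ifPn => [ij|_]; last by rewrite mulr0 mul0r.
  case: ijs; apply/allpairsP; exists (i, j); rewrite !inE /=.
  by split => //; lia.
rewrite -fsbig_seq //= !big_cons big_nil /stencil3 /=.
rewrite !expiD /expi !(mulr0, mulr1, mulrN1, cos0, sin0, cosN, sinN, mulrN).
apply/eqP; rewrite eq_complex /=; apply/andP; split; apply/eqP; ring.
Qed.

Lemma laplace5_symbol (R : realType) (h : R) : h != 0 ->
  is_symbol (stencil_op h (laplace5 h))
    (fun theta => (h ^- 2 * (4 - 2 * (cos theta.1 + cos theta.2)))%:C).
Proof.
move=> h0 theta x; rewrite /laplace5 stencil3_symbol //.
by congr ((h ^- 2 * _)%:C * _); ring.
Qed.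

Lemma mass_fe_symbol (R : realType) (h : R) : h != 0 ->
  is_symbol (stencil_op h (mass_fe h))
    (fun theta => (h ^+ 2 / 9 * ((2 + cos theta.1) * (2 + cos theta.2)))%:C).
Proof.
move=> h0 theta x; rewrite /mass_fe stencil3_symbol //.
by congr (_%:C * _); field.
Qed.

Lemma stencil_opZ (R : realType) (h : R) (s : int * int -> R) (c : R[i])
    (u : gridfun h) :
  stencil_op h s (fun x => c * u x) = fun x => c * stencil_op h s u x.
Proof.
apply/funext => x; rewrite /stencil_op mulr_fsumr.
by apply: eq_fsbigr => k _; rewrite mulrCA.
Qed.

Lemma cos_le0_pihalf (R : realType) (x : R) :
  pi / 2 <= x <= 3 * pi / 2 -> cos x <= 0.
Proof.
move=> ?; rewrite -[x](subrK pi) cosDpi oppr_le0 cos_ge0_pihalf //; lra.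
Qed.

(** Outside the low square, some coordinate lies in [[pi / 2, 3 * pi / 2[]. *)
Lemma T_high_cos_le0 (R : realType) (theta : R * R) :
  T_high theta -> cos theta.1 <= 0 \/ cos theta.2 <= 0.
Proof.
case: theta => s t [] [] /=; rewrite !in_itv /= => sI tI low.
have [?|?] := leP (pi / 2) s; first by left; apply: cos_le0_pihalf; lra.
have [?|?] := leP (pi / 2) t; first by right; apply: cos_le0_pihalf; lra.
by case: low; split; lra.
Qed.

(* The product of the two symbols, with a = cos theta1 and b = cos theta2. *)
Definition fe_product {R : realType} (a b : R) : R :=
  2 / 9 * ((2 + a) * (2 + b) * (2 - a - b)).

Lemma fe_productC (R : realType) (a b : R) : fe_product a b = fe_product b a.
Proof. by rewrite /fe_product; ring. Qed.

Lemma fe_product_bounds (R : realType) (a b : R) :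
  -1 <= a <= 1 -> -1 <= b <= 1 -> a <= 0 \/ b <= 0 ->
  8 / 9 <= fe_product a b <= 16 / 9.
Proof.
wlog b0 : a b / b <= 0 => [hwlog aI bI [a0|b0]|].
- by rewrite fe_productC; apply: hwlog => //; right.
- by apply: hwlog => //; right.
move=> aI bI _; rewrite /fe_product; apply/andP; split.
- (* Concavity in [a]: the product exceeds the chord between [a = -1] and
     [a = 1] by a multiple of [(1 - a) * (1 + a) * (2 + b)], and at these two
     ends the excess over the bound is a multiple of the other two factors. *)
  have ? : 0 <= (1 - a) * (1 + a) * (2 + b) by rewrite !mulr_ge0 //; lra.
  have ? : 0 <= - b * (1 + b) by rewrite mulr_ge0 //; lra.
  have ? : 0 <= (1 + a) * (2 + 3 * (- b * (1 + b))) by rewrite mulr_ge0 //; lra.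
  have ? : 0 <= (1 - a) * ((1 + b) * (2 - b)) by rewrite !mulr_ge0 //; lra.
  lra.
(* Completing the square in [a]: [8 - (2 + a) * (2 + b) * (2 - a - b)] equals this term plus a
   quarter of the next. *)
- have ? : 0 <= (a + b / 2) ^+ 2 * (2 + b) by rewrite mulr_ge0 ?sqr_ge0 //; lra.
  have ? : 0 <= b ^+ 2 * (6 - b) by rewrite mulr_ge0 ?sqr_ge0 //; lra.
  lra.
Qed.

(** The modulus of an affine function of [z] is convex, hence largest at an endpoint; the signs of
    [w] and [1 - w * z] tell which. *)
Lemma normB_le_max (R : realType) (w z l u : R) : l <= z <= u ->
  `|1 - w * z| <= Num.max `|1 - w * l| `|1 - w * u|.
Proof.
move=> /andP[lz zu]; rewrite le_max.
have [w0|w0] := leP 0 w.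
- have ? := ler_wpM2l w0 lz; have ? := ler_wpM2l w0 zu.
  have [?|?] := leP 0 (1 - w * z); apply/orP; [left|right].
  + by rewrite !ger0_norm; lra.
  + by rewrite !ltr0_norm; lra.
- have ? := ler_wnM2l (ltW w0) lz; have ? := ler_wnM2l (ltW w0) zu.
  have [?|?] := leP 0 (1 - w * z); apply/orP; [right|left].
  + by rewrite !ger0_norm; lra.
  + by rewrite !ltr0_norm; lra.
Qed.

Lemma T_high_pi (R : realType) : T_high (pi : R, pi).
Proof.
have := pi_gt0 R => pi0.
by split; [split; rewrite /= in_itv /=; lra | case; rewrite /= in_itv /=; lra].
Qed.

Lemma T_high_pihalf (R : realType) : T_high (pi / 2 : R, pi / 2).
Proof.
have := pi_gt0 R => pi0.
by split; [split; rewrite /= in_itv /=; lra | case; rewrite /= in_itv /=; lra].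
Qed.

Theorem theorem3p4 (R : realType) (h : R) (h_gt0 : 0 < h)
    (At Mt : R * R -> R[i])
    (AtP : is_symbol (stencil_op h (laplace5 h)) At)
    (MtP : is_symbol (stencil_op h (mass_fe h)) Mt) :
  (forall omega : R,
     is_symbol (S_fe h omega)
       (fun theta => 1 - omega%:C * Mt theta * At theta)) /\
  exists mu : R -> R,
    (forall omega : R,
       is_smoothing_factor
         (fun theta => 1 - omega%:C * Mt theta * At theta) (mu omega)) /\
    is_minimum (range mu) (1 / 3) /\
    (forall omega : R, mu omega = 1 / 3 <-> omega = 3 / 4).
Proof.
have h0 : h != 0 by rewrite gt_eqF.
split=> [omega theta x|].
  (* Fourier modes are eigenfunctions of the inner operator, so by linearity of the outer one the
     symbols multiply. *)
  rewrite /S_fe (_ : stencil_op h (laplace5 h) _ =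
                     fun y => At theta * fourier_mode theta y).
    by rewrite stencil_opZ MtP; ring.
  by apply/funext => y; rewrite AtP.
have symbolE omega theta : Normc.normc (1 - omega%:C * Mt theta * At theta) =
    `|1 - omega * fe_product (cos theta.1) (cos theta.2)|.
  (* Uniqueness of symbols makes [At] and [Mt] explicit; the powers of [h] then cancel. *)
  rewrite (is_symbol_unique AtP (laplace5_symbol _ _ h0)).
  rewrite (is_symbol_unique MtP (mass_fe_symbol _ _ h0)).
  rewrite -[1]/(1%:C) -!rmorphM -rmorphB /= expr0n addr0 sqrtr_sqr.
  by congr `|1 - _|; rewrite /fe_product; field.
pose mu (omega : R) := Num.max `|1 - omega * (8 / 9)| `|1 - omega * (16 / 9)|.
have mu_ge omega : 1 - omega * (8 / 9) <= mu omega /\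
                   omega * (16 / 9) - 1 <= mu omega.
  split; rewrite /mu le_max; apply/orP; [left|right]; first exact: ler_norm.
  by rewrite distrC ler_norm.
have mu_opt : mu (3 / 4) = 1 / 3.
  rewrite /mu ger0_norm ?ler0_norm; try lra.
  by rewrite maxEle; case: ifP; lra.
exists mu; split; last split.
- move=> omega; split=> [|_ [theta theta_high <-]].
    rewrite /mu maxEle; case: ifP => _.
      exists (pi / 2, pi / 2); first exact: T_high_pihalf.
      by rewrite symbolE /= cos_pihalf /fe_product; congr `|1 - omega * _|; field.
    exists (pi, pi); first exact: T_high_pi.
    by rewrite symbolE /= cospi /fe_product; congr `|1 - omega * _|; field.
  rewrite symbolE; apply/normB_le_max/fe_product_bounds.
  + by rewrite cos_geN1 cos_le1.
  + by rewrite cos_geN1 cos_le1.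
  + exact: T_high_cos_le0.
- split; first by exists (3 / 4).
  (* Twice the first bound plus the second eliminates [omega]: [1 <= 3 * mu omega]. *)
  by move=> _ [omega _ <-]; have := mu_ge omega; lra.
- move=> omega; split=> [muE|->//].
  (* At the value [1 / 3] the two bounds read [3 / 4 <= omega] and [omega <= 3 / 4]. *)
  by have := mu_ge omega; rewrite muE; lra.
Qed.
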